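(* (In ZFC set theory.) For a graph $G$ the following are equivalent: (a) $G$ is a generalized Cayley graph of a left-cancellative magma with a right identity; (b) $G$ is a generalized Cayley graph of a left-cancellative magma with an identity; (c) $G$ is simple, deterministic, source-complete and loop-complete.
   Context: A graph is a non-empty set $G\subseteq V\times A\times V$ of labeled edges $s\xrightarrow{a}_G t$; $V_G$ is the set of vertices occurring in edges, $A_G$ the set of labels. A graph is a generalized Cayley graph of a magma $(M,\cdot)$ if it equals $\mathcal{C}\langle M,Q\rangle=\{(p,\langle q\rangle,p\cdot q): p\in M,\ q\in Q\}$ for some $Q\subseteq M$ and injective $\langle\,\rangle:Q\to A$. A magma is left-cancellative if $r\cdot p=r\cdot q\Rightarrow p=q$; $e$ is a right identity if $p\cdot e=p$ for all $p$, and an identity if also $e\cdot p=p$ for all $p$. $G$ is simple if no two edges share source and target; deterministic if $r\xrightarrow{a}s$, $r\xrightarrow{a}t$ imply $s=t$; source-complete if for every $s\in V_G$ and $a\in A_G$ there is $t$ with $s\xrightarrow{a}_G t$; loop-complete if whenever some vertex has an $a$-labeled loop $r\xrightarrow{a}_G r$, every vertex $s\in V_G$ has $s\xrightarrow{a}_G s$. *)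

(* Defs.v *)
From HB Require Import structures.
From mathcomp Require Import all_boot.
From mathcomp Require Import boolp classical_sets.

Set Implicit Arguments.
Unset Strict Implicit.
Unset Printing Implicit Defensive.

Local Open Scope classical_set_scope.

Record graph (V A : Type) := Graph {
  edges : set (V * A * V);
  edges_neq0 : edges !=set0
}.

Section Graphs.
Context {V A : Type}.
Implicit Type G : graph V A.

Definition edge G (s : V) (a : A) (t : V) : Prop := edges G (s, a, t).

Definition vertices G : set V :=
  [set s | exists a t, edge G s a t \/ edge G t a s].

Definition labels G : set A := [set a | exists s t, edge G s a t].

Definition simple G : Prop :=
  forall s a b t, edge G s a t -> edge G s b t -> a = b.

Definition deterministic G : Prop :=
  forall r a s t, edge G r a s -> edge G r a t -> s = t.

Definition source_complete G : Prop :=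
  forall s a, vertices G s -> labels G a -> exists t, edge G s a t.

Definition loop_complete G : Prop :=
  forall a, (exists r, edge G r a r) -> forall s, vertices G s -> edge G s a s.

End Graphs.

(* A magma whose underlying set is a subset of V.  An equality of sets
   G = C<M, Q> with G non-empty forces M to be included in V, so no other
   magma can have G as a generalized Cayley graph. *)
Record magma_in (V : Type) := MagmaIn {
  carrier : set V;
  carrier_magma : Magma carrier
}.

Definition magma_of (V : Type) (M : magma_in V) : magmaType :=
  Magma.Pack (carrier_magma M).
Coercion magma_of : magma_in >-> magmaType.

Definition elt (V : Type) (M : magma_in V) (p : M) : V :=
  \val (p : carrier M).

(* [right_injective op] reads: op r p = op r q implies p = q. *)
Definition left_cancellative (M : magmaType) : Prop :=
  right_injective (@monoid.mul M).

Definition is_right_identity (M : magmaType) (e : M) : Prop :=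
  right_id e (@monoid.mul M).

Definition is_identity (M : magmaType) (e : M) : Prop :=
  is_right_identity e /\ left_id e (@monoid.mul M).

Definition cayley (V A : Type) (M : magma_in V) (Q : set M) (label : Q -> A) :
    set (V * A * V) :=
  [set u | exists (p : M) (q : Q),
     u = (elt p, label q, elt (p * \val q)%g)].

Definition is_gen_cayley (V A : Type) (G : graph V A) (M : magma_in V) : Prop :=
  exists (Q : set M) (label : Q -> A),
    injective label /\ edges G = cayley label.

(* Main.v *)
Require Import Defs.
From mathcomp Require Import all_boot.
From mathcomp Require Import boolp classical_sets.

(** For (c) -> (b), regard a magma on the vertex set T as its set of columns
    p |-> p * q, which are functions T -> T.  It is left-cancellative iff
    distinct columns differ at every point.  The identity function together
    with the maps "follow the edge labeled a" is such a family of columns, by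
    simplicity, determinism and loop-completeness.  By Zorn's lemma it extends
    to a maximal one, and in a maximal one some row r takes every value, since
    otherwise a function avoiding all values in each row could be added.
    Naming each column by its value at r then gives the multiplication, with
    identity r. *)

Set Implicit Arguments.
Unset Strict Implicit.
Unset Printing Implicit Defensive.

Local Open Scope classical_set_scope.

Definition separated (I U : Type) (S : set (I -> U)) : Prop :=
  forall f g i, S f -> S g -> f i = g i -> f = g.

(** Two members of the union already lie in one member of the chain. Keeping [S0] outside [F] also
    covers the empty chain. *)
Lemma separated_bigcup (I U : Type) (S0 : set (I -> U))
    (F : set (set (I -> U))) :
  separated S0 -> (forall S, F S -> separated (S0 `|` S)) ->
  total_on F subset -> separated (S0 `|` \bigcup_(S in F) S).
Proof.
move=> sep0 sepF totF f g i [Sf|[S FS Sf]] [Sg|[S' FS' Sg]] efg.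
- exact: (sep0 f g i).
- by apply: (sepF S' FS' f g i) => //; [left|right].
- by apply: (sepF S FS f g i) => //; [right|left].
- have [SS'|S'S] := totF _ _ FS FS'.
  + by apply: (sepF S' FS' f g i) => //; right => //; apply: SS'.
  + by apply: (sepF S FS f g i) => //; right => //; apply: S'S.
Qed.

Lemma separated_extension (I U : Type) (i0 : I) (S0 : set (I -> U)) :
  separated S0 ->
  exists S, [/\ S0 `<=` S, separated S &
    exists i, forall u, exists2 f, S f & f i = u].
Proof.
move=> sep0.
have [F FP totF|S [sepS maxS]] :=
    @Zorn_bigcup _ (fun S => separated (S0 `|` S)).
  exact: separated_bigcup.
exists (S0 `|` S); split=> [f|//|]; first by left.
apply: contrapT => nosurj.
(* With no surjective row, choose in each row [i] a value [x i] that no column takes there; [x] can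
   then be added to [S]. *)
have /choice[x xP] i : exists u, forall f, (S0 `|` S) f -> f i <> u.
  apply: contrapT => nou; apply: nosurj; exists i => u.
  apply: contrapT => nof; apply: nou; exists u => f Sf fiu.
  by apply: nof; exists f.
apply: (maxS (S `|` [set x])).
  split=> [f|sub]; first by left.
  (* The extension is proper: if [x] were in [S], then [x i0] would differ from itself. *)
  by apply: (xP i0 x) => //; right; apply: sub; right.
have split_x f : (S0 `|` (S `|` [set x])) f -> (S0 `|` S) f \/ f = x.
  by case=> [Sf|[Sf|->]]; [left; left|left; right|right].
move=> f g i /split_x[Sf|->] /split_x[Sg|->] // efg.
- exact: (sepS f g i).
- by case: (xP i f Sf).
- by case: (xP i g Sg).
Qed.

(** By separatedness a column is determined by its value at [r], so [col q] is the only column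
    sending [r] to [q]; in particular [col r] is [id]. *)
Lemma left_cancellative_identity (T : Type) (S : set (T -> T)) (r : T) :
  separated S -> S id -> (forall u, exists2 f, S f & f r = u) ->
  exists op : T -> T -> T,
    [/\ right_injective op, right_id r op, left_id r op
      & forall f, S f -> forall p, op p (f r) = f p].
Proof.
move=> sepS Sid surjS.
have /choice[col colP] u : exists f, S f /\ f r = u.
  by have [f] := surjS u; exists f.
have colE f : S f -> col (f r) = f.
  by move=> Sf; have [Sc ec] := colP (f r); apply: sepS ec.
exists (fun p q => col q p); split=> [p q q' epq|p|q|f Sf p].
- have [[Sq eq] [Sq' eq']] := (colP q, colP q').
  by rewrite -eq -eq' (sepS _ _ _ Sq Sq' epq).
- by rewrite (colE id).
- by have [] := colP q.
- by rewrite colE.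
Qed.

Section Columns.
Variables (V A : Type) (G : graph V A).

Lemma vertices_source s a t : edge G s a t -> vertices G s.
Proof. by move=> e; exists a, t; left. Qed.

Lemma vertices_target s a t : edge G s a t -> vertices G t.
Proof. by move=> e; exists a, s; right. Qed.

Definition follows (a : A) (f : vertices G -> vertices G) : Prop :=
  forall s, edge G (val s) a (val (f s)).

Definition columns : set (vertices G -> vertices G) :=
  [set f | f = id \/ exists a, follows a f].

Lemma follows_inj a f g :
  deterministic G -> follows a f -> follows a g -> f = g.
Proof. by move=> det af ag; apply/funext => s; apply/val_inj/(det _ a). Qed.

Lemma follows_exists a :
  source_complete G -> labels G a -> exists f, follows a f.
Proof.
move=> src aG; suff /choice[f fP] : forall s : vertices G,
  exists t : vertices G, edge G (val s) a (val t) by exists f.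
move=> s; have [t st] := src _ _ (set_valP s) aG.
by exists (SigSub (mem_set (vertices_target st))).
Qed.

Lemma separated_columns :
  simple G -> deterministic G -> loop_complete G -> separated columns.
Proof.
move=> sim det loop.
(* A fixed point of [f] is an [a]-loop; loop-completeness spreads it to all vertices, and
   determinism then leaves only [id]. *)
have loopE a f s : follows a f -> f s = s -> f = id.
  move=> af fs; apply: (follows_inj (a := a)) => // t.
  apply: loop (set_valP t).
  by exists (val s); rewrite -[in X in edge _ _ _ X]fs.
move=> f g i [->|[a af]] [->|[b bg]] //= efg.
- by rewrite (loopE b g i).
- by rewrite (loopE a f i).
(* Agreement at [i] gives parallel edges, so simplicity identifies the two labels. *)
- have /sim ab := af i; move: af; rewrite (ab b) => [af|].
    exact: follows_inj af bg.
  by rewrite efg.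
Qed.

Lemma gen_cayley_identity :
  simple G -> deterministic G -> source_complete G -> loop_complete G ->
  exists M : magma_in V,
    [/\ left_cancellative M, exists e : M, is_identity e & is_gen_cayley G M].
Proof.
move=> sim det src loop.
have [[[s0 a0] t0] e0] := edges_neq0 G.
pose v0 : vertices G := SigSub (mem_set (@vertices_source s0 a0 t0 e0)).
have [S [subS sepS [r surjS]]] :=
  @separated_extension _ _ v0 _ (separated_columns sim det loop).
have [op [opI opr1 op1r opE]] :=
  @left_cancellative_identity _ S r sepS (subS id (or_introl erefl)) surjS.
have opF a f : follows a f -> forall p, op p (f r) = f p.
  by move=> af; apply: opE; apply: subS; right; exists a.
pose M := @MagmaIn V (vertices G) (Magma.Class (hasMul.Axioms_ op)).
exists M; split=> //; first by exists r; split.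
(* This choice is forced: as [r] is an identity, the edge from [r] labeled by [q] must end at
   [r * q = q]. *)
pose Q : set M := [set q | exists a, edge G (elt (r : M)) a (elt q)].
pose label (q : Q) : A := projT1 (cid (set_valP q)).
have labelP (q : Q) : edge G (elt (r : M)) (label q) (elt (val q)).
  by rewrite /label; case: cid.
exists Q, label; split.
  move=> q q' eqq'; apply/val_inj/val_inj/(det _ (label q)); first exact: labelP.
  by rewrite eqq'; exact: labelP.
apply/seteqP; split=> [[[s a] t] st|_ [p [q ->]]].
  (* The generator for the label [a] is [f r], whose column is [f]; hence [p * f r = f p] is the
     target of the [a]-edge at [p]. *)
  have [f af] : exists f, follows a f by apply: follows_exists => //; exists s, t.
  have Qf : Q (f r) by exists a; exact: af.
  pose p : vertices G := SigSub (mem_set (vertices_source st)).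
  exists p, (SigSub (mem_set Qf)); congr (_, _, _).
    by apply: sim (af r) _; exact: (labelP (SigSub (mem_set Qf))).
  by rewrite /elt /monoid.mul /= (opF a f af); exact: (det _ _ _ _ st (af p)).
have [f af] : exists f, follows (label q) f.
  by apply: follows_exists => //; exists (elt (r : M)), (elt (val q)).
have -> : val q = f r by apply/val_inj/(det _ _ _ _ (labelP q))/af.
by rewrite /elt /monoid.mul /= (opF _ f af); exact: (af p).
Qed.

Lemma gen_cayley_properties (M : magma_in V) (e : M) :
  left_cancellative M -> is_right_identity e -> is_gen_cayley G M ->
  [/\ simple G, deterministic G, source_complete G & loop_complete G].
Proof.
move=> MI e1 [Q [label [labelI GE]]].
have edgeP s a t : edge G s a t <-> exists (p : M) (q : Q),
    [/\ s = elt p, a = label q & t = elt (p * val q)%g].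
  rewrite /edge GE; split=> [[p [q [-> -> ->]]]|[p [q [-> -> ->]]]];
  by exists p, q.
have eltI : injective (@elt V M) by move=> p q /val_inj.
have vertexP s : vertices G s -> exists p : M, s = elt p.
  by move=> [a [t [] /edgeP[p [q [ps _ ts]]]]]; [exists p|exists (p * val q)%g].
split.
- move=> s a b t /edgeP[p [q [-> -> ->]]] /edgeP[p' [q' [/eltI <- ->]]].
  by move=> /eltI /MI /val_inj ->.
- move=> s a t u /edgeP[p [q [-> -> ->]]] /edgeP[p' [q' [/eltI <-]]].
  by move=> /labelI <- ->.
- move=> s a /vertexP[p ->] [s' [t' /edgeP[p' [q [_ -> _]]]]].
  by exists (elt (p * val q)%g); apply/edgeP; exists p, q.
- move=> a [s /edgeP[p [q [-> -> /eltI pq]]]] t /vertexP[p' ->].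
  (* A loop says [p * q = p = p * e], so cancellation makes its generator the right identity, which
     gives loops everywhere. *)
  have qe : val q = e by apply: (MI p); rewrite -pq e1.
  by apply/edgeP; exists p', q; rewrite qe e1.
Qed.

End Columns.

Theorem theorem5p7 (V A : Type) (G : graph V A) :
  [<-> exists M : magma_in V,
         [/\ left_cancellative M, exists e : M, is_right_identity e
           & is_gen_cayley G M];
       exists M : magma_in V,
         [/\ left_cancellative M, exists e : M, is_identity e
           & is_gen_cayley G M];
       [/\ simple G, deterministic G, source_complete G & loop_complete G]].
Proof.
tfae=> [[M [MI [e e1] GM]]|[M [MI [e [e1 _]] GM]]|[sim det src loop]].
(* The magma with an identity is not derived from [M] but rebuilt from the graph, through (c). *)
- have [sim det src loop] := gen_cayley_properties MI e1 GM.
  exact: gen_cayley_identity.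
- exact: gen_cayley_properties MI e1 GM.
- have [M [MI [e [e1 _]] GM]] := gen_cayley_identity sim det src loop.
  by exists M; split=> //; exists e.
Qed.
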